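(* Let $I\subset\mathbb{R}$ be an open interval and let $x: I\to E_1^4$ be a regular spacelike curve in Minkowski space-time, parameterized by arclength $s$, with Frenet frame $\{T,N,B_1,B_2\}$, causal sign $\varepsilon_1=g(N,N)\in\{+1,-1\}$, and curvature functions $k_1,k_2,k_3$, all nowhere zero on $I$. Then $x$ is a helix in $E_1^4$ if and only if there exists a $C^2$-function $f:I\to\mathbb{R}$ such that $$f k_3=\frac{d}{ds}\left(\frac{k_1}{k_2}\right),\qquad \frac{d}{ds}f(s)=\varepsilon_1k_3\frac{k_1}{k_2}$$ on $I$.
   Context: Minkowski space-time $E_1^4$ is $\mathbb{R}^4$ with the metric $g=-dx_1^2+dx_2^2+dx_3^2+dx_4^2$. A vector $v$ is spacelike if $g(v,v)>0$ or $v=0$, timelike if $g(v,v)<0$, and null (lightlike) if $g(v,v)=0$ and $v\ne 0$. A curve is spacelike if all its velocity vectors are spacelike; it is parameterized by arclength $s$ if $g(x'(s),x'(s))=1$. Curves are assumed sufficiently smooth. Frenet frame: along an arclength-parameterized spacelike curve $x(s)$ there is a moving frame $\{T,N,B_1,B_2\}$ of mutually orthogonal vector fields (tangent $T=x'$, principal normal, first binormal, second binormal) with $$g(T,T)=1,\quad g(N,N)=\varepsilon_1,\quad g(B_2,B_2)=\varepsilon_2,\quad g(B_1,B_1)=-\varepsilon_1\varepsilon_2,\quad \varepsilon_1=\pm1,\ \varepsilon_2=\pm1,$$ where $(\varepsilon_1,\varepsilon_2)\in\{(1,1),(1,-1),(-1,1)\}$, satisfying the Frenet equations $$T'=k_1N,\quad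 N'=-\varepsilon_1k_1T+k_2B_1,\quad B_1'=\varepsilon_2k_2N+k_3B_2,\quad B_2'=\varepsilon_1k_3B_1.$$ The functions $k_1,k_2,k_3$ are the first, second and third curvatures. It is assumed throughout that $k_i(s)\neq 0$ for all $s$ and $1\le i\le 3$. Helix: a spacelike curve in $E_1^4$ is a (general) helix if its unit tangent indicatrix $s\mapsto T(s)$ is contained in a hyperplane (not necessarily through the origin), that is, if there is a nonzero constant vector $U\in E_1^4$ (the axis, which may be spacelike, timelike or null) such that $g(T(s),U)$ is constant. *)

(* Defs.v *)
From HB Require Import structures.
From mathcomp Require Import all_boot all_order all_algebra.
From mathcomp Require Import all_classical all_reals all_analysis.

Set Implicit Arguments.
Unset Strict Implicit.
Unset Printing Implicit Defensive.

Import Order.TTheory GRing.Theory Num.Theory.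
Import numFieldNormedType.Exports.

Local Open Scope classical_set_scope.
Local Open Scope ring_scope.

(* Curves and functions on an open interval I are total functions on R whose
   values outside I are irrelevant: I being open, every derivative at a point
   of I depends only on the restriction to I. *)
Definition open_interval (R : realType) (I : set R) : Prop :=
  open I /\ is_interval I.

Definition Cn_on (R : realType) (V : normedModType R) (n : nat) (I : set R)
    (f : R -> V) : Prop :=
  (forall k s, (k < n)%N -> I s -> derivable (derive1n k f) s 1) /\
  (forall k s, (k <= n)%N -> I s -> {for s, continuous (derive1n k f)}).

(* The coordinates x_1, ..., x_4 are indexed by 0, ..., 3. *)
Definition mink (R : realType) (u v : 'rV[R]_4) : R :=
  - (u 0 0 * v 0 0) + u 0 1 * v 0 1 + u 0 2 * v 0 2 + u 0 3 * v 0 3.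

Definition spacelike (R : realType) (v : 'rV[R]_4) : Prop :=
  0 < mink v v \/ v = 0.

(* C^5 is the class for which k1, k2, k3 are C^3, C^2 and C^1 respectively. *)
Record spacelike_arclength_curve (R : realType) (I : set R)
    (x : R -> 'rV[R]_4) : Prop := SpacelikeArclengthCurve {
  curve_smooth : Cn_on 5 I x ;
  curve_regular : forall s, I s -> derive1 x s != 0 ;
  curve_spacelike : forall s, I s -> spacelike (derive1 x s) ;
  curve_arclength : forall s, I s -> mink (derive1 x s) (derive1 x s) = 1
}.

Definition frame_signs (R : realType) (e1 e2 : R) : Prop :=
  [\/ e1 = 1 /\ e2 = 1, e1 = 1 /\ e2 = -1 | e1 = -1 /\ e2 = 1].

Record frenet_frame (R : realType) (I : set R) (x : R -> 'rV[R]_4)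
    (e1 e2 : R) (k1 k2 k3 : R -> R) (T N B1 B2 : R -> 'rV[R]_4) : Prop :=
  FrenetFrame {
  frenet_signs : frame_signs e1 e2 ;
  frenet_tangent : forall s, I s -> T s = derive1 x s ;
  frenet_TT : forall s, I s -> mink (T s) (T s) = 1 ;
  frenet_NN : forall s, I s -> mink (N s) (N s) = e1 ;
  frenet_B1B1 : forall s, I s -> mink (B1 s) (B1 s) = - (e1 * e2) ;
  frenet_B2B2 : forall s, I s -> mink (B2 s) (B2 s) = e2 ;
  frenet_TN : forall s, I s -> mink (T s) (N s) = 0 ;
  frenet_TB1 : forall s, I s -> mink (T s) (B1 s) = 0 ;
  frenet_TB2 : forall s, I s -> mink (T s) (B2 s) = 0 ;
  frenet_NB1 : forall s, I s -> mink (N s) (B1 s) = 0 ;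
  frenet_NB2 : forall s, I s -> mink (N s) (B2 s) = 0 ;
  frenet_B1B2 : forall s, I s -> mink (B1 s) (B2 s) = 0 ;
  frenet_dT : forall s, I s -> is_derive s 1 T (k1 s *: N s) ;
  frenet_dN : forall s, I s ->
    is_derive s 1 N (- (e1 * k1 s) *: T s + k2 s *: B1 s) ;
  frenet_dB1 : forall s, I s ->
    is_derive s 1 B1 ((e2 * k2 s) *: N s + k3 s *: B2 s) ;
  frenet_dB2 : forall s, I s -> is_derive s 1 B2 ((e1 * k3 s) *: B1 s)
}.

Definition helix (R : realType) (I : set R) (x : R -> 'rV[R]_4) : Prop :=
  exists2 U : 'rV[R]_4, U != 0 &
    exists c : R, forall s, I s -> mink (derive1 x s) U = c.

(* Main.v *)
Require Import Defs.
From HB Require Import structures.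
From mathcomp Require Import all_boot all_order all_algebra.
From mathcomp Require Import all_classical all_reals all_analysis.
From mathcomp Require Import ring.

Set Implicit Arguments.
Unset Strict Implicit.
Unset Printing Implicit Defensive.

Import Order.TTheory GRing.Theory Num.Theory.
Import numFieldNormedType.Exports.

Local Open Scope classical_set_scope.
Local Open Scope ring_scope.

(** Fix a constant vector [U] with [g(T,U) = c] and differentiate along the
Frenet equations, writing [h] for the harmonic curvature [k1 / k2].
The equation [k1 g(N,U) = 0] gives [g(N,U) = 0]; differentiating this one gives
[g(B1,U) = e1 c h], and differentiating again gives
[e1 c h' = k3 g(B2,U)] and [g(B2,U)' = k3 c h]
([frenet_axis_components]).  When [c] is nonzero these are exactly the two
required equations for [f = e1 g(B2,U) / c].  When [c = 0] all four products of
[U] with the frame vanish, which contradicts [U != 0] because an orthogonal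
frame of non-null vectors detects every vector ([mink_orthogonal_eq0]).

Conversely, a solution [f] tells what the axis has to be: the vector whose
products with the frame are those found above for [c = 1], namely
[U = T - e2 h B1 + e1 e2 f B2].  The two equations for [h] and [f] together with
the Frenet equations say that [U] has zero derivative, so [U] is constant on the
interval [I], and [g(T,U) = 1] shows that it is a nonzero axis.

What remains is that [f] is of class C^2.  As [f' = e1 k3 h], it is enough that
the curvatures are of class C^1.  The Frenet equations present [k1 N], [k2 B1]
and [k3 B2] in turn as combinations of known vectors with one derivative less
than their predecessors, and a factorization [W = k M] with [g(M,M)] constant
transmits the whole regularity of [W] to both [k] and [M]
([Cn_on_normalize]).  Starting from a C^5 curve this yields [k1], [k2], [k3] of
class C^3, C^2, C^1 ([frenet_curvatures_smooth]). *)

(** * Derivatives on open intervals *)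

Lemma is_derive_derive1 (R : realType) (V : normedModType R) (f : R -> V)
    (s : R) (df : V) : is_derive s 1 f df -> derive1 f s = df.
Proof. by move=> [_ <-]; rewrite derive1E. Qed.

Lemma derivable_is_derive1 (R : realType) (V : normedModType R) (f : R -> V)
    (s : R) : derivable f s 1 -> is_derive s 1 f (derive1 f s).
Proof. by move=> df; rewrite derive1E; split. Qed.

Lemma is_derive_continuous (R : realType) (V : normedModType R) (f : R -> V)
    (s : R) (df : V) : is_derive s 1 f df -> {for s, continuous f}.
Proof. by move=> [+ _] => /derivable1_diffP /differentiable_continuous. Qed.

Lemma is_derive_interval_cst (R : realType) (I : set R) (f : R -> R)
    (hI : open_interval I) (df : forall s, I s -> is_derive s 1 f 0) (a b : R) :
  I a -> I b -> f a = f b.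
Proof.
have [_ itvI] := hI.
wlog ab : a b / a <= b => [hw Ia Ib|Ia Ib].
  by have [/hw|/ltW/hw] := leP a b; [apply|move=> ->].
have sub z : z \in `[a, b] -> I z by rewrite in_itv /=; exact: itvI.
have [| |c _] := @MVT_segment R f (cst 0) a b ab.
- by move=> s /subset_itv_oo_cc /sub; exact: df.
- apply: continuous_in_subspaceT => s /set_mem /sub.
  by move=> /df; exact: is_derive_continuous.
- by rewrite mul0r => /eqP; rewrite subr_eq0 => /eqP.
Qed.

(** * Functions of class C^n on an open set *)

Section Cn.
Variables (R : realType) (I : set R).
Hypothesis oI : open I.

Lemma near_eq_on (T : Type) (f g : R -> T) (s : R) :
  (forall t, I t -> f t = g t) -> I s -> \forall t \near s, f t = g t.
Proof.
by move=> fg Is; apply: filterS (open_nbhs_nbhs (conj oI Is)) => t /fg.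
Qed.

Lemma is_derive_eq_cst (f : R -> R) (c s df : R) :
  (forall t, I t -> f t = c) -> I s -> is_derive s 1 f df -> df = 0.
Proof.
move=> fc Is [_ <-].
by rewrite (near_eq_derive _ (near_eq_on fc Is)) derive_cst.
Qed.

Lemma Cn_on0 (V : normedModType R) (f : R -> V) :
  Cn_on 0 I f <-> forall s, I s -> {for s, continuous f}.
Proof.
split=> [[_ cf] s Is|cf]; first exact: cf 0%N s isT Is.
by split=> // k s; rewrite leqn0 => /eqP ->; exact: cf.
Qed.

(** Gives class C^n the recursive form that the inductions below run on: the
continuity of [f] itself is implied by its derivability. *)
Lemma Cn_onS n (V : normedModType R) (f : R -> V) :
  Cn_on n.+1 I f <->
  (forall s, I s -> derivable f s 1) /\ Cn_on n I (derive1 f).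
Proof.
split=> [[df cf]|[df [ddf cdf]]].
  split=> [s Is|]; first exact: df 0%N s isT Is.
  by split=> k s kn; rewrite -derive1Sn; [exact: df|exact: cf].
split=> -[|k] s; rewrite ?ltnS => kn Is.
- exact: df.
- by rewrite derive1Sn; exact: ddf.
- exact: is_derive_continuous (derivable_is_derive1 (df s Is)).
- by rewrite derive1Sn; exact: cdf.
Qed.

Lemma Cn_on_derive1 n (V : normedModType R) (f : R -> V) :
  Cn_on n.+1 I f -> Cn_on n I (derive1 f).
Proof. by case/Cn_onS. Qed.

Lemma Cn_onW m n (V : normedModType R) (f : R -> V) :
  (m <= n)%N -> Cn_on n I f -> Cn_on m I f.
Proof.
by move=> mn [df cf]; split=> k s km; [apply: df|apply: cf];
  exact: leq_trans km mn.
Qed.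

Lemma eq_Cn_on n (V : normedModType R) (f g : R -> V) :
  (forall s, I s -> f s = g s) -> Cn_on n I f -> Cn_on n I g.
Proof.
elim: n f g => [|n IHn] f g fg.
  rewrite !Cn_on0 => cf s Is; have := cf s Is.
  rewrite /prop_for /continuous_at -(fg s Is) => cfs.
  by apply: cvg_trans cfs; apply: near_eq_cvg; exact: near_eq_on.
rewrite !Cn_onS => -[df cdf]; split=> [s Is|].
  by apply: near_eq_derivable (df s Is); exact: near_eq_on.
apply: IHn cdf => s Is; rewrite !derive1E.
by apply: near_eq_derive; exact: near_eq_on.
Qed.

Lemma is_derive_Cn_on n (V : normedModType R) (f g : R -> V) :
  (forall s, I s -> is_derive s 1 f (g s)) -> Cn_on n I g -> Cn_on n.+1 I f.
Proof.
move=> fg cg; apply/Cn_onS; split=> [s /fg[]//|].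
by apply: eq_Cn_on cg => s /fg /is_derive_derive1.
Qed.

Lemma Cn_on_derive n (V : normedModType R) (f g : R -> V) :
  (forall s, I s -> is_derive s 1 f (g s)) -> Cn_on n.+1 I f -> Cn_on n I g.
Proof.
move=> fg /Cn_onS[_]; apply: eq_Cn_on => s /fg; exact: is_derive_derive1.
Qed.

Lemma Cn_on_is_derive n (V : normedModType R) (f : R -> V) (s : R) :
  Cn_on n.+1 I f -> I s -> is_derive s 1 f (derive1 f s).
Proof. by move=> /Cn_onS[df _] Is; exact/derivable_is_derive1/df. Qed.

Lemma Cn_on_cst n (V : normedModType R) (v : V) : Cn_on n I (fun=> v).
Proof.
elim: n v => [|n IHn] v; first by apply/Cn_on0 => s _; exact: cvg_cst.
by apply: is_derive_Cn_on (IHn 0) => s _; exact: is_derive_cst.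
Qed.

Lemma Cn_onD n (V : normedModType R) (f g : R -> V) :
  Cn_on n I f -> Cn_on n I g -> Cn_on n I (fun s => f s + g s).
Proof.
elim: n f g => [|n IHn] f g cf cg.
  apply/Cn_on0 => s Is; apply: continuousD.
    exact: (Cn_on0 f).1 cf s Is.
  exact: (Cn_on0 g).1 cg s Is.
apply: (is_derive_Cn_on (g := fun s => derive1 f s + derive1 g s)).
  move=> s Is; exact: is_deriveD (Cn_on_is_derive cf Is) (Cn_on_is_derive cg Is).
exact: (IHn _ _ (Cn_on_derive1 cf) (Cn_on_derive1 cg)).
Qed.

Lemma Cn_onM n (f g : R -> R) :
  Cn_on n I f -> Cn_on n I g -> Cn_on n I (fun s => f s * g s).
Proof.
elim: n f g => [|n IHn] f g cf cg.
  apply/Cn_on0 => s Is; apply: continuousM.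
    exact: (Cn_on0 f).1 cf s Is.
  exact: (Cn_on0 g).1 cg s Is.
apply: (is_derive_Cn_on
  (g := fun s => f s * derive1 g s + g s * derive1 f s)).
  move=> s Is; exact: is_deriveM (Cn_on_is_derive cf Is) (Cn_on_is_derive cg Is).
apply: Cn_onD; apply: IHn.
- exact: Cn_onW cf.
- exact: (Cn_on_derive1 cg).
- exact: Cn_onW cg.
- exact: (Cn_on_derive1 cf).
Qed.

Lemma Cn_onV n (f : R -> R) :
  (forall s, I s -> f s != 0) -> Cn_on n I f -> Cn_on n I (fun s => (f s)^-1).
Proof.
move=> f0; elim: n => [|n IHn] cf.
  by apply/Cn_on0 => s Is; apply: continuousV; [exact: f0|
    exact: (Cn_on0 f).1 cf s Is].
apply: (is_derive_Cn_on
  (g := fun s => -1 * ((f s)^-1 * (f s)^-1) * derive1 f s)).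
  move=> s Is; apply: is_derive_eq.
    exact: is_deriveV (f0 s Is) (Cn_on_is_derive cf Is).
  by rewrite -exprVn expr2 mulN1r.
have cV := IHn (Cn_onW (leqnSn n) cf).
exact: (Cn_onM (Cn_onM (Cn_on_cst _ _) (Cn_onM cV cV)) (Cn_on_derive1 cf)).
Qed.

Lemma continuous_mxP m n (M : R -> 'M[R]_(m, n)) (s : R) :
  {for s, continuous M} <->
  forall i j, {for s, continuous (fun t => M t i j)}.
Proof.
split=> [cM i j|cM].
  exact: (continuous_comp cM (@coord_continuous R m n i j (M s))).
apply/cvgrPdist_le => /= e e0; near=> t.
rewrite /Num.Def.normr/= mx_normrE (bigmax_le _ (ltW e0))//= => i _.
rewrite !mxE/=; move: i; near: t; apply: filter_forall => /= i.
exact: ((cvgrPdist_le _ _).1 (cM i.1 i.2)).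
Unshelve. all: by end_near. Qed.

Lemma is_derive_mxP m n (M : R -> 'M[R]_(m, n)) (s : R) (dM : 'M[R]_(m, n)) :
  is_derive s 1 M dM <->
  forall i j, is_derive s 1 (fun t => M t i j) (dM i j).
Proof.
split=> [[dfM <-] i j|dfM].
  rewrite derive_mx // mxE; split=> //.
  exact: (derivable_mxP M s 1).1 dfM i j.
have dfM' : derivable M s 1 by apply/derivable_mxP => i j; case: (dfM i j).
split=> //; rewrite derive_mx //; apply/matrixP => i j; rewrite mxE.
by case: (dfM i j).
Qed.

Lemma Cn_on_mxP k m n (M : R -> 'M[R]_(m, n)) :
  Cn_on k I M <-> forall i j, Cn_on k I (fun s => M s i j).
Proof.
elim: k M => [|k IHk] M.
  rewrite Cn_on0; split=> [cM i j|cM s Is].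
    by apply/Cn_on0 => s /cM /continuous_mxP.
  by apply/continuous_mxP => i j; exact: (Cn_on0 _).1 (cM i j) s Is.
split=> [cM i j|cM].
  apply: (is_derive_Cn_on (g := fun s => derive1 M s i j)).
    move=> s Is; exact: (is_derive_mxP _ _ _).1 (Cn_on_is_derive cM Is) i j.
  exact: ((IHk _).1 (Cn_on_derive1 cM) i j).
apply: (is_derive_Cn_on
  (g := fun s => \matrix_(i, j) derive1 (fun t => M t i j) s)).
  move=> s Is; apply/is_derive_mxP => i j; rewrite mxE.
  exact: Cn_on_is_derive (cM i j) Is.
apply/IHk => i j; apply: eq_Cn_on (Cn_on_derive1 (cM i j)) => s _.
by rewrite mxE.
Qed.

Lemma Cn_on_scale k m n (a : R -> R) (M : R -> 'M[R]_(m, n)) :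
  Cn_on k I a -> Cn_on k I M -> Cn_on k I (fun s => a s *: M s).
Proof.
move=> ca /Cn_on_mxP cM; apply/Cn_on_mxP => i j.
by apply: eq_Cn_on (Cn_onM ca (cM i j)) => s _; rewrite mxE.
Qed.

End Cn.

(** * The Minkowski product *)

Section Mink.
Variable R : realType.
Implicit Types (u v w : 'rV[R]_4) (a : R).

Lemma minkC u v : mink u v = mink v u.
Proof. by rewrite /mink; ring. Qed.

Lemma minkDl u v w : mink (u + v) w = mink u w + mink v w.
Proof. by rewrite /mink !mxE; ring. Qed.

Lemma minkZl a u w : mink (a *: u) w = a * mink u w.
Proof. by rewrite /mink !mxE; ring. Qed.

Lemma mink0l u : mink 0 u = 0.
Proof. by rewrite /mink !mxE; ring. Qed.

Definition mink_gram : 'M[R]_4 :=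
  diag_mx (\row_i (if i == 0 then -1 else 1)).

Lemma mink_gramE u v : mink u v = (u *m mink_gram *m v^T) 0 0.
Proof.
rewrite /mink_gram mul_mx_diag mxE !big_ord_recl big_ord0 !mxE /= /mink.
have -> : lift ord0 (ord0 : 'I_3) = 1 :> 'I_4 by exact: val_inj.
have -> : lift ord0 (lift ord0 (ord0 : 'I_2)) = 2 :> 'I_4 by exact: val_inj.
have -> : lift ord0 (lift ord0 (lift ord0 (ord0 : 'I_1))) = 3 :> 'I_4.
  exact: val_inj.
by ring.
Qed.

(** If [F] has the rows [E i] and [G] is the Gram matrix, [F G F^T] is diagonal
with nonzero diagonal, so [F G] is invertible and [F G u^T = 0] forces
[u = 0]. *)
Lemma mink_orthogonal_eq0 (E : 'I_4 -> 'rV[R]_4) u :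
  (forall i, mink (E i) (E i) != 0) ->
  (forall i j, i != j -> mink (E i) (E j) = 0) ->
  (forall i, mink (E i) u = 0) -> u = 0.
Proof.
move=> E0 Eorth Eu; pose F := \matrix_i E i.
have FGF : F *m mink_gram *m F^T = diag_mx (\row_i mink (E i) (E i)).
  apply/matrixP => i j; rewrite !mxE.
  transitivity (mink (E i) (E j)).
    rewrite mink_gramE mxE; apply: eq_bigr => k _.
    by rewrite -[in RHS](rowK E i) -row_mul !mxE.
  by have [<-|/Eorth] := eqVneq i j; rewrite ?mulr1n ?mulr0n.
have Funit : F *m mink_gram \in unitmx.
  have : \det (F *m mink_gram *m F^T) != 0.
    rewrite FGF det_diag; apply/prodf_neq0 => i _; rewrite mxE; exact: E0.
  by rewrite det_mulmx unitmxE unitfE; apply: contraNneq => ->; rewrite mul0r.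
have FGu : F *m mink_gram *m u^T = 0.
  apply/matrixP => i j; rewrite [RHS]mxE ord1 -(Eu i) mink_gramE.
  rewrite !mxE; apply: eq_bigr => k _.
  by rewrite -[in RHS](rowK E i) -row_mul !mxE.
by rewrite -[u]trmxK -(mulKmx Funit u^T) FGu mulmx0 trmx0.
Qed.

Lemma is_derive_mink (u v : R -> 'rV[R]_4) (s : R) du dv :
  is_derive s 1 u du -> is_derive s 1 v dv ->
  is_derive s 1 (fun t => mink (u t) (v t)) (mink du (v s) + mink (u s) dv).
Proof.
move=> /is_derive_mxP hu /is_derive_mxP hv.
have huv i := is_deriveM (hu 0 i) (hv 0 i).
apply: is_derive_eq (is_deriveD (is_deriveD (is_deriveD (is_deriveN (huv 0))
  (huv 1)) (huv 2)) (huv 3)) _.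
by rewrite /mink /GRing.scale /=; ring.
Qed.

Lemma is_derive_minkl (u : R -> 'rV[R]_4) (s : R) du w :
  is_derive s 1 u du -> is_derive s 1 (fun t => mink (u t) w) (mink du w).
Proof.
move=> hu; apply: is_derive_eq (is_derive_mink hu (is_derive_cst w s 1)) _.
by rewrite (minkC _ 0) mink0l addr0.
Qed.

End Mink.

Section MinkCn.
Variables (R : realType) (I : set R).
Hypothesis oI : open I.

Lemma Cn_on_mink n (u v : R -> 'rV[R]_4) :
  Cn_on n I u -> Cn_on n I v -> Cn_on n I (fun s => mink (u s) (v s)).
Proof.
move=> /(Cn_on_mxP oI) cu /(Cn_on_mxP oI) cv.
have cuv i : Cn_on n I (fun s => u s 0 i * v s 0 i) by exact: Cn_onM.
apply: (eq_Cn_on oI (f := fun s => -1 * (u s 0 0 * v s 0 0)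
  + u s 0 1 * v s 0 1 + u s 0 2 * v s 0 2 + u s 0 3 * v s 0 3)).
  by move=> s _; rewrite mulN1r.
exact: (Cn_onD oI (Cn_onD oI (Cn_onD oI
  (Cn_onM oI (Cn_on_cst oI _ _) (cuv 0)) (cuv 1)) (cuv 2)) (cuv 3)).
Qed.

(** As [e = g(M,M)] is constant, [M'] is orthogonal to [M], hence to [W], and
[k = e^-1 g(W,M)] has derivative [e^-1 g(W',M)].  This derivative involves [M]
but not [M'], so [M] of class C^n gives [k] of class C^n.+1, and then
[M = k^-1 W] is of class C^n.+1 too: mere derivability of [M] is enough to start
the induction. *)
Lemma Cn_on_normalize n (W M : R -> 'rV[R]_4) (k : R -> R) e :
  e != 0 ->
  (forall s, I s -> mink (M s) (M s) = e) ->
  (forall s, I s -> derivable M s 1) ->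
  (forall s, I s -> k s != 0) ->
  (forall s, I s -> W s = k s *: M s) ->
  Cn_on n I W -> Cn_on n I k /\ Cn_on n I M.
Proof.
move=> e0 MM dM k0 WkM.
have kE s : I s -> e^-1 * mink (W s) (M s) = k s.
  by move=> Is; rewrite WkM // minkZl MM // mulrC mulfK.
have dMM s : I s -> mink (M s) (derive1 M s) = 0.
  move=> Is; have hM := derivable_is_derive1 (dM s Is).
  have := is_derive_eq_cst oI MM Is (is_derive_mink hM hM).
  by rewrite [X in X + _]minkC => /eqP; rewrite -mulr2n mulrn_eq0 => /eqP.
elim: n => [|n IHn] cW.
  have cM : Cn_on 0 I M.
    apply/Cn_on0 => s Is.
    exact: is_derive_continuous (derivable_is_derive1 (dM s Is)).
  split=> //; apply: (eq_Cn_on oI kE).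
  exact: (Cn_onM oI (Cn_on_cst oI _ _) (Cn_on_mink cW cM)).
have [_ cM] := IHn (Cn_onW (leqnSn n) cW).
have ck : Cn_on n.+1 I k.
  apply: (eq_Cn_on oI kE).
  apply: (is_derive_Cn_on oI (g := fun s => e^-1 * mink (derive1 W s) (M s))).
    move=> s Is.
    have hW := Cn_on_is_derive cW Is.
    have hM := derivable_is_derive1 (dM s Is).
    apply: is_derive_eq (is_deriveZ e^-1 (is_derive_mink hW hM)) _.
    by rewrite (WkM s Is) minkZl dMM // mulr0 addr0.
  exact: (Cn_onM oI (Cn_on_cst oI _ _) (Cn_on_mink (Cn_on_derive1 cW) cM)).
split; first exact: ck.
apply: (eq_Cn_on oI) (Cn_on_scale oI (Cn_onV oI k0 ck) cW).
by move=> s Is; rewrite WkM // scalerA mulVf ?k0 // scale1r.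
Qed.

End MinkCn.

(** * Spacelike curves with a Frenet frame *)

Lemma frame_signs_sqr (R : realType) (e1 e2 : R) :
  frame_signs e1 e2 -> e1 * e1 = 1 /\ e2 * e2 = 1.
Proof. by case=> -[-> ->]; rewrite ?mulrNN !mulr1. Qed.

Section Frenet.
Variables (R : realType) (I : set R) (x : R -> 'rV[R]_4) (e1 e2 : R).
Variables (k1 k2 k3 : R -> R) (T N B1 B2 : R -> 'rV[R]_4).
Hypothesis hI : open_interval I.
Hypothesis hF : frenet_frame I x e1 e2 k1 k2 k3 T N B1 B2.
Hypothesis hk1 : forall s, I s -> k1 s != 0.
Hypothesis hk2 : forall s, I s -> k2 s != 0.
Hypothesis hk3 : forall s, I s -> k3 s != 0.

Let oI : open I := hI.1.
Let e1K : e1 * e1 = 1 := (frame_signs_sqr (frenet_signs hF)).1.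
Let e2K : e2 * e2 = 1 := (frame_signs_sqr (frenet_signs hF)).2.

Let e1_neq0 : e1 != 0.
Proof. by apply: contra_eq_neq e1K => ->; rewrite mulr0 eq_sym oner_eq0. Qed.

Let e2_neq0 : e2 != 0.
Proof. by apply: contra_eq_neq e2K => ->; rewrite mulr0 eq_sym oner_eq0. Qed.

Lemma frenet_orthogonal_eq0 s u : I s ->
  mink (T s) u = 0 -> mink (N s) u = 0 -> mink (B1 s) u = 0 ->
  mink (B2 s) u = 0 -> u = 0.
Proof.
move=> Is Tu Nu B1u B2u.
pose E (i : 'I_4) := [:: T s; N s; B1 s; B2 s]`_i.
apply: (@mink_orthogonal_eq0 _ E) => [[[|[|[|[|//]]]] ?]|i j|].
- by rewrite /E/= (frenet_TT hF) // oner_eq0.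
- by rewrite /E/= (frenet_NN hF).
- by rewrite /E/= (frenet_B1B1 hF) // oppr_eq0 mulf_neq0.
- by rewrite /E/= (frenet_B2B2 hF).
- wlog: i j / (i < j)%N => [hw ij|].
    have [| |/val_inj eij] := ltngtP i j; first by move=> /hw; apply.
      by move=> /hw; rewrite minkC eq_sym; apply.
    by rewrite eij eqxx in ij.
  have [TN TB1] := (frenet_TN hF Is, frenet_TB1 hF Is).
  have [TB2 NB1] := (frenet_TB2 hF Is, frenet_NB1 hF Is).
  have [NB2 B12] := (frenet_NB2 hF Is, frenet_B1B2 hF Is).
  by case: i j => [[|[|[|[|//]]]] ?] [[|[|[|[|//]]]] ?].
- by case=> [[|[|[|[|//]]]] ?].
Qed.

Lemma frenet_curvatures_smooth : Cn_on 5 I x ->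
  [/\ Cn_on 3 I k1, Cn_on 2 I k2 & Cn_on 1 I k3].
Proof.
move=> /Cn_onS[_ cx].
have cT : Cn_on 4 I T.
  by apply: (eq_Cn_on oI) cx => s Is; rewrite (frenet_tangent hF Is).
have [ck1 cN] : Cn_on 3 I k1 /\ Cn_on 3 I N.
  apply: (Cn_on_normalize (W := fun s => k1 s *: N s) oI e1_neq0
    (frenet_NN hF) _ hk1) => //.
    by move=> s /(frenet_dN hF)[].
  exact: (Cn_on_derive oI (frenet_dT hF) cT).
have [ck2 cB1] : Cn_on 2 I k2 /\ Cn_on 2 I B1.
  have e12 : - (e1 * e2) != 0 by rewrite oppr_eq0 mulf_neq0.
  (* [W] is N' with its T-component removed. *)
  apply: (Cn_on_normalize (W := fun s => (- (e1 * k1 s) *: T s + k2 s *: B1 s)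
    + (e1 * k1 s) *: T s) oI e12 (frenet_B1B1 hF) _ hk2).
  - by move=> s /(frenet_dB1 hF)[].
  - by move=> s Is; rewrite addrAC scaleNr addNr add0r.
  apply: (Cn_onD oI (Cn_on_derive oI (frenet_dN hF) cN)).
  apply: (Cn_on_scale oI); last exact: Cn_onW cT.
  by apply: (Cn_onM oI); [exact: Cn_on_cst|exact: Cn_onW ck1].
have [ck3 _] : Cn_on 1 I k3 /\ Cn_on 1 I B2.
  apply: (Cn_on_normalize (W := fun s => ((e2 * k2 s) *: N s + k3 s *: B2 s)
    + (- (e2 * k2 s)) *: N s) oI e2_neq0 (frenet_B2B2 hF) _ hk3).
  - by move=> s /(frenet_dB2 hF)[].
  - by move=> s Is; rewrite addrAC scaleNr addrN add0r.
  apply: (Cn_onD oI (Cn_on_derive oI (frenet_dB1 hF) cB1)).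
  apply: (Cn_on_scale oI); last exact: Cn_onW cN.
  apply: (eq_Cn_on oI (f := fun s => - e2 * k2 s)).
    by move=> s _; rewrite mulNr.
  by apply: (Cn_onM oI); [exact: Cn_on_cst|exact: Cn_onW ck2].
by [].
Qed.

(** The constancy of [g(T,U)], then that of [g(N,U)], are differentiated; the
nonvanishing of [k1] and of [k2] allows solving for [g(N,U)] and [g(B1,U)].  The
last two claims are the derivatives of [g(B1,U)] and [g(B2,U)], rewritten with
these values. *)
Lemma frenet_axis_components (U : 'rV[R]_4) (c s : R) :
  (forall t, I t -> mink (T t) U = c) -> I s ->
  [/\ mink (N s) U = 0, mink (B1 s) U = e1 * c * (k1 s / k2 s),
      is_derive s 1 (fun t => e1 * c * (k1 t / k2 t)) (k3 s * mink (B2 s) U) &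
      is_derive s 1 (fun t => mink (B2 t) U) (k3 s * (c * (k1 s / k2 s)))].
Proof.
move=> TU.
have NU t : I t -> mink (N t) U = 0.
  move=> It; have := is_derive_eq_cst oI TU It
    (is_derive_minkl U (frenet_dT hF It)).
  by rewrite minkZl => /eqP; rewrite mulf_eq0 (negPf (hk1 It)) => /eqP.
have B1U t : I t -> mink (B1 t) U = e1 * c * (k1 t / k2 t).
  move=> It; have := is_derive_eq_cst oI NU It
    (is_derive_minkl U (frenet_dN hF It)).
  rewrite minkDl !minkZl TU // mulNr addrC => /subr0_eq kB.
  by apply: (mulfI (hk2 It)); rewrite kB; field; exact: hk2.
move=> Is; split; [exact: NU|exact: B1U| |].
- apply: near_eq_is_derive (near_eq_on oI B1U Is) _.
  apply: is_derive_eq (is_derive_minkl U (frenet_dB1 hF Is)) _.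
  by rewrite minkDl !minkZl NU // mulr0 add0r.
- apply: is_derive_eq (is_derive_minkl U (frenet_dB2 hF Is)) _.
  by rewrite minkZl B1U // -[RHS]mul1r -e1K; ring.
Qed.

Lemma helix_harmonic_curvature : helix I x ->
  exists f : R -> R, forall s, I s ->
      is_derive s 1 (fun t => k1 t / k2 t) (f s * k3 s) /\
      is_derive s 1 f (e1 * k3 s * (k1 s / k2 s)).
Proof.
move=> [U U0 [c xU]].
have TU s : I s -> mink (T s) U = c.
  by move=> Is; rewrite (frenet_tangent hF Is) xU.
have [c0|c0] := eqVneq c 0.
  (* Existence of a point of [I] is what makes [c = 0] contradictory, so [f]
     is chosen first; on an empty [I] any value works. *)
  exists (fun=> 0) => s Is; exfalso; move/eqP: U0; apply.
  have [NU B1U _ _] := frenet_axis_components TU Is.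
  have B1U0 t : I t -> mink (B1 t) U = 0.
    move=> It; have [_ -> _ _] := frenet_axis_components TU It.
    by rewrite c0 mulr0 mul0r.
  apply: (frenet_orthogonal_eq0 Is) => //; first by rewrite TU.
    exact: B1U0.
  have := is_derive_eq_cst oI B1U0 Is (is_derive_minkl U (frenet_dB1 hF Is)).
  rewrite minkDl !minkZl NU mulr0 add0r => /eqP.
  by rewrite mulf_eq0 (negPf (hk3 Is)) => /eqP.
exists (fun s => e1 / c * mink (B2 s) U) => s Is.
have [_ _ dk dB2U] := frenet_axis_components TU Is; split.
  have ec : e1 * c != 0 by rewrite mulf_neq0.
  have -> : (fun t => k1 t / k2 t) =
      (e1 * c)^-1 \*: (fun t => e1 * c * (k1 t / k2 t)).
    by apply/funext => t; rewrite /= /GRing.scale /= mulKf.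
  apply: is_derive_eq (is_deriveZ (e1 * c)^-1 dk) _.
  have e1V : e1^-1 = e1 by apply: (mulfI e1_neq0); rewrite mulfV.
  by rewrite /GRing.scale /= invfM e1V; ring.
apply: is_derive_eq (is_deriveZ (e1 / c) dB2U) _.
by rewrite /GRing.scale /=; field; rewrite c0 hk2.
Qed.

(** The coefficients of [axis] are the products with the frame dictated by
[frenet_axis_components] for [c = 1], divided by the squared norms [- e1 e2] and
[e2] of [B1] and [B2]. *)
Lemma harmonic_curvature_helix (f : R -> R) :
  (forall s, I s ->
      is_derive s 1 (fun t => k1 t / k2 t) (f s * k3 s) /\
      is_derive s 1 f (e1 * k3 s * (k1 s / k2 s))) -> helix I x.
Proof.
move=> hf.
have [[s0 Is0]|I0] := pselect (exists s, I s); last first.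
  exists (const_mx 1); last by exists 0 => s Is; case: I0; exists s.
  by apply/eqP => /matrixP /(_ 0 0) /eqP; rewrite !mxE oner_eq0.
pose axis s :=
  T s + (- (e2 * (k1 s / k2 s)) *: B1 s + (e1 * e2 * f s) *: B2 s).
have axisE s w : mink (axis s) w = mink (T s) w +
    (- e2 * (k1 s / k2 s * mink (B1 s) w) +
     e1 * e2 * (f s * mink (B2 s) w)).
  by rewrite !minkDl !minkZl; ring.
have Taxis s : I s -> mink (axis s) (T s) = 1.
  move=> Is; rewrite axisE (frenet_TT hF Is) !(minkC _ (T s)).
  by rewrite (frenet_TB1 hF Is) (frenet_TB2 hF Is) !mulr0 !addr0.
have daxis w s : I s -> is_derive s 1 (fun t => mink (axis t) w) 0.
  move=> Is; have [dk df] := hf s Is.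
  have dT := is_derive_minkl w (frenet_dT hF Is).
  have dB1 := is_derive_minkl w (frenet_dB1 hF Is).
  have dB2 := is_derive_minkl w (frenet_dB2 hF Is).
  have := is_deriveD dT (is_deriveD (is_deriveZ (- e2) (is_deriveM dk dB1))
    (is_deriveZ (e1 * e2) (is_deriveM df dB2))).
  set axw := (X in is_derive s 1 X _) => d.
  have -> : (fun t => mink (axis t) w) = axw.
    by apply/funext => t; rewrite axisE.
  apply: is_derive_eq d _.
  rewrite !minkDl !minkZl /GRing.scale /=.
  set n := mink (N s) w; set b1 := mink (B1 s) w; set b2 := mink (B2 s) w.
  (* The factors [e2 * e2] and [k2 s] make the terms in [n] cancel formally. *)
  have -> : k1 s * n = (e2 * e2) * (k1 s / k2 s * k2 s * n).
    by rewrite e2K divfK ?hk2 // mul1r.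
  (* What remains is a multiple of [e1 * e1 - 1]. *)
  transitivity (e2 * f s * k3 s * b1 * (e1 * e1 - 1) +
    e2 * (k1 s / k2 s) * k3 s * b2 * (e1 * e1 - 1)); first by ring.
  by rewrite e1K; ring.
exists (axis s0).
  apply: contraTneq isT => axis0; have := Taxis s0 Is0.
  by rewrite axis0 mink0l => /eqP; rewrite eq_sym oner_eq0.
(* Constancy of [axis] is tested against the fixed vector [T s]. *)
exists 1 => s Is; rewrite -(frenet_tangent hF Is) minkC -(Taxis s Is).
exact: is_derive_interval_cst hI (daxis (T s)) _ _ Is0 Is.
Qed.

End Frenet.

Unset Implicit Arguments.

Theorem theorem3p2 (R : realType) (I : set R) (x : R -> 'rV[R]_4)
    (e1 e2 : R) (k1 k2 k3 : R -> R) (T N B1 B2 : R -> 'rV[R]_4)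
    (hI : open_interval I)
    (hx : spacelike_arclength_curve I x)
    (hF : frenet_frame I x e1 e2 k1 k2 k3 T N B1 B2)
    (hk1 : forall s, I s -> k1 s != 0)
    (hk2 : forall s, I s -> k2 s != 0)
    (hk3 : forall s, I s -> k3 s != 0) :
  helix I x <->
  exists2 f : R -> R, Cn_on 2 I f &
    forall s, I s ->
      is_derive s 1 (fun t => k1 t / k2 t) (f s * k3 s) /\
      is_derive s 1 f (e1 * k3 s * (k1 s / k2 s)).
Proof.
split=> [|[f _]]; last exact: harmonic_curvature_helix hI hF hk2 _.
move=> /(helix_harmonic_curvature hI hF hk1 hk2 hk3)[f hf]; exists f => //.
have [ck1 ck2 ck3] :=
  frenet_curvatures_smooth hI hF hk1 hk2 hk3 (curve_smooth hx).
apply: (is_derive_Cn_on hI.1 (fun s Is => (hf s Is).2)).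
have ck12 : Cn_on 1 I (fun s => k1 s / k2 s).
  apply: (Cn_onM hI.1); first exact: Cn_onW ck1.
  by apply: (Cn_onV hI.1 hk2); exact: Cn_onW ck2.
exact: (Cn_onM hI.1 (Cn_onM hI.1 (Cn_on_cst hI.1 _ _) ck3) ck12).
Qed.
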